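(* Let $B$ be an unbounded non-negative self-adjoint operator in $\mathcal{H}$ with $\ker B=\{0\}$ and $\operatorname{ran}B\neq\mathcal{H}$. Then there exist two linear manifolds $\mathfrak{D}_1,\mathfrak{D}_2\subset\operatorname{dom}B$ such that (1) $\mathfrak{D}_1+\mathfrak{D}_2=\operatorname{dom}B$; (2) $B\mathfrak{D}_1$ and $B\mathfrak{D}_2$ are dense in $\mathcal{H}$. Moreover, $\mathfrak{D}_1,\mathfrak{D}_2$ can be chosen such that $\mathfrak{D}_1\cap\mathfrak{D}_2=\{0\}$ and $\mathfrak{D}_1\perp\mathfrak{D}_2$ with respect to the graph inner product $(f,g)_B:=(Bf,Bg)+(f,g)$, so that $\operatorname{dom}B=\mathfrak{D}_1\oplus_B\mathfrak{D}_2$.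
   Context: $\mathcal{H}$ is a complex, infinite-dimensional, separable Hilbert space; $\oplus_B$ denotes an orthogonal direct sum with respect to the graph inner product $(\cdot,\cdot)_B$. *)

(* Defs.v *)
From Stdlib Require Import Reals.
Open Scope R_scope.

Definition C : Type := (R * R)%type.
Definition C0 : C := (0, 0).
Definition C1 : C := (1, 0).
Definition Cadd (a b : C) : C := (fst a + fst b, snd a + snd b).
Definition Cmul (a b : C) : C :=
  (fst a * fst b - snd a * snd b, fst a * snd b + snd a * fst b).
Definition Cconj (a : C) : C := (fst a, - snd a).

Record CHilbert : Type := {
  carrier :> Type;
  vzero : carrier;
  vadd : carrier -> carrier -> carrier;
  vopp : carrier -> carrier;
  vscal : C -> carrier -> carrier;
  inner : carrier -> carrier -> C;
  vadd_assoc : forall x y z, vadd x (vadd y z) = vadd (vadd x y) z;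
  vadd_comm : forall x y, vadd x y = vadd y x;
  vadd_0l : forall x, vadd vzero x = x;
  vadd_oppl : forall x, vadd (vopp x) x = vzero;
  vscal_1 : forall x, vscal C1 x = x;
  vscal_assoc : forall a b x, vscal a (vscal b x) = vscal (Cmul a b) x;
  vscal_addr : forall a x y, vscal a (vadd x y) = vadd (vscal a x) (vscal a y);
  vscal_addl : forall a b x, vscal (Cadd a b) x = vadd (vscal a x) (vscal b x);
  inner_addl : forall x y z, inner (vadd x y) z = Cadd (inner x z) (inner y z);
  inner_scall : forall a x y, inner (vscal a x) y = Cmul a (inner x y);
  inner_conj : forall x y, inner y x = Cconj (inner x y);
  inner_pos : forall x, 0 <= fst (inner x x);
  inner_def : forall x, inner x x = C0 -> x = vzero;
  complete : forall u : nat -> carrier,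
    (forall eps, 0 < eps -> exists N, forall m n, (N <= m)%nat -> (N <= n)%nat ->
       sqrt (fst (inner (vadd (u m) (vopp (u n))) (vadd (u m) (vopp (u n))))) < eps) ->
    exists l, forall eps, 0 < eps -> exists N, forall n, (N <= n)%nat ->
       sqrt (fst (inner (vadd (u n) (vopp l)) (vadd (u n) (vopp l)))) < eps
}.

Arguments vzero {_}.
Arguments vadd {_} _ _.
Arguments vopp {_} _.
Arguments vscal {_} _ _.
Arguments inner {_} _ _.

Section Ops.
Variable H : CHilbert.

Definition vsub (x y : H) : H := vadd x (vopp y).
Definition hnorm (x : H) : R := sqrt (fst (inner x x)).

Fixpoint lincomb (n : nat) (c : nat -> C) (e : nat -> H) : H :=
  match n with
  | O => vzero
  | S k => vadd (lincomb k c e) (vscal (c k) (e k))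
  end.

Definition dense (S : H -> Prop) : Prop :=
  forall x eps, 0 < eps -> exists y, S y /\ hnorm (vsub x y) < eps.

Definition separable : Prop :=
  exists e : nat -> H, dense (fun y => exists n, y = e n).

Definition infinite_dimensional : Prop :=
  forall n : nat, exists e : nat -> H,
    forall c : nat -> C, lincomb n c e = vzero -> forall i, (i < n)%nat -> c i = C0.

Definition linear_manifold (S : H -> Prop) : Prop :=
  S vzero /\ (forall x y, S x -> S y -> S (vadd x y)) /\
  (forall a x, S x -> S (vscal a x)).

(** An (unbounded) operator is a pair (dom, B) with B : H -> H; only its
    values on dom matter. *)
Definition linear_operator (dom : H -> Prop) (B : H -> H) : Prop :=
  linear_manifold dom /\
  (forall x y, dom x -> dom y -> B (vadd x y) = vadd (B x) (B y)) /\
  (forall a x, dom x -> B (vscal a x) = vscal a (B x)).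

(** B = B^* : densely defined, dom B^* = dom B and B^* = B on it. *)
Definition self_adjoint (dom : H -> Prop) (B : H -> H) : Prop :=
  linear_operator dom B /\ dense dom /\
  (forall y, dom y <-> exists z, forall x, dom x -> inner (B x) y = inner x z) /\
  (forall x y, dom x -> dom y -> inner (B x) y = inner x (B y)).

Definition nonnegative (dom : H -> Prop) (B : H -> H) : Prop :=
  forall x, dom x -> 0 <= fst (inner (B x) x).

Definition unbounded (dom : H -> Prop) (B : H -> H) : Prop :=
  ~ exists c : R, forall x, dom x -> hnorm (B x) <= c * hnorm x.

Definition trivial_kernel (dom : H -> Prop) (B : H -> H) : Prop :=
  forall x, dom x -> B x = vzero -> x = vzero.

Definition range_not_whole (dom : H -> Prop) (B : H -> H) : Prop :=
  exists y : H, ~ exists x, dom x /\ B x = y.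

Definition image (B : H -> H) (S : H -> Prop) : H -> Prop :=
  fun y => exists x, S x /\ B x = y.

Definition graph_inner (B : H -> H) (f g : H) : C :=
  Cadd (inner (B f) (B g)) (inner f g).

End Ops.

Arguments vsub {_} _ _.
Arguments hnorm {_} _.

(* Main.v *)
(** Let [K] be [dom B] with the graph inner product, a Hilbert space because [B] is
    closed, and let [b : K -> H] be the contraction induced by [B], with adjoint [a].
    Duality turns density of [b (F^perp)], for a finite-dimensional [F], into
    [F /\ ran a = 0].  Since [b] is injective with dense non-closed range, a gliding hump
    shows that [ran a] has infinite codimension in [K], and so one can enlarge
    alternately two graph-orthogonal finite-dimensional subspaces that meet [ran a]
    trivially, bringing their images under [b] closer and closer to each point of a dense
    sequence of [H].  [D1] is the graph-orthogonal complement of the union of the second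
    family, and [D2] that of [D1]. *)
Require Import Defs.
From Stdlib Require Import Reals.
From Stdlib Require Import Lra Lia List Classical ClassicalEpsilon Cantor.
Import ListNotations.

(** * Calculus of the real part of the inner product *)

Definition re {H : CHilbert} (x y : H) : R := fst (inner x y).
(** Multiplication by [i]. By [inner_re], [re] and [J] together recover the complex inner product,
    so that computations can be carried out with real numbers. *)
Definition J {H : CHilbert} (x : H) : H := vscal (0, 1) x.
Definition rscal {H : CHilbert} (t : R) (x : H) : H := vscal (t, 0) x.

Section InnerProduct.
Variable H : CHilbert.
Implicit Types (x y z : H) (c : Defs.C) (t : R).

Lemma re_addl x y z : re (vadd x y) z = re x z + re y z.
Proof. unfold re. rewrite inner_addl. reflexivity. Qed.

Lemma re_sym x y : re x y = re y x.
Proof. unfold re. rewrite (inner_conj H y x). reflexivity. Qed.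

Lemma re_J_sym x y : re (J x) y = - re (J y) x.
Proof.
  unfold re, J. rewrite !inner_scall, (inner_conj H y x). simpl. ring.
Qed.

Lemma re_zerol z : re vzero z = 0.
Proof. pose proof (re_addl vzero vzero z) as E. rewrite vadd_0l in E. lra. Qed.

Lemma re_oppl x z : re (vopp x) z = - re x z.
Proof.
  pose proof (re_addl (vopp x) x z) as E. rewrite vadd_oppl, re_zerol in E. lra.
Qed.

Lemma re_scall c x z : re (vscal c x) z = fst c * re x z + snd c * re (J x) z.
Proof. unfold re, J. rewrite !inner_scall. simpl. ring. Qed.

Lemma re_J_addl x y z : re (J (vadd x y)) z = re (J x) z + re (J y) z.
Proof. unfold J. rewrite vscal_addr. apply re_addl. Qed.

Lemma re_J_zerol z : re (J vzero) z = 0.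
Proof.
  pose proof (re_J_addl vzero vzero z) as E. rewrite vadd_0l in E. lra.
Qed.

Lemma re_J_oppl x z : re (J (vopp x)) z = - re (J x) z.
Proof.
  pose proof (re_J_addl (vopp x) x z) as E. rewrite vadd_oppl, re_J_zerol in E. lra.
Qed.

Lemma re_J_scall c x z :
  re (J (vscal c x)) z = fst c * re (J x) z - snd c * re x z.
Proof. unfold re, J. rewrite !inner_scall. simpl. ring. Qed.

Lemma re_J_J x z : re (J (J x)) z = - re x z.
Proof. unfold re, J. rewrite !inner_scall. simpl. ring. Qed.

Lemma re_addr x y z : re z (vadd x y) = re z x + re z y.
Proof. rewrite !(re_sym z). apply re_addl. Qed.

Lemma re_zeror z : re z vzero = 0.
Proof. rewrite re_sym. apply re_zerol. Qed.

Lemma re_oppr x z : re z (vopp x) = - re z x.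
Proof. rewrite !(re_sym z). apply re_oppl. Qed.

Lemma re_scalr c x z : re z (vscal c x) = fst c * re z x - snd c * re (J z) x.
Proof. rewrite re_sym, re_scall, (re_J_sym x z), (re_sym x z). ring. Qed.

Lemma re_Jr x z : re z (J x) = - re (J z) x.
Proof. rewrite re_sym, re_J_sym. ring. Qed.

Lemma re_rscall t x z : re (rscal t x) z = t * re x z.
Proof. unfold rscal. rewrite re_scall. simpl. ring. Qed.

Lemma re_rscalr t x z : re z (rscal t x) = t * re z x.
Proof. rewrite !(re_sym z). apply re_rscall. Qed.

Lemma re_J_rscall t x z : re (J (rscal t x)) z = t * re (J x) z.
Proof. unfold rscal. rewrite re_J_scall. simpl. ring. Qed.

Lemma inner_re x y : inner x y = (re x y, - re (J x) y).
Proof.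
  unfold re, J. rewrite inner_scall. destruct (inner x y). simpl. f_equal. ring.
Qed.

End InnerProduct.

Global Hint Rewrite re_addl re_zerol re_oppl re_scall re_J_addl re_J_zerol re_J_oppl
  re_J_scall re_J_J re_addr re_zeror re_oppr re_scalr re_Jr re_rscall re_rscalr
  re_J_rscall : re.

(** Identities between vectors are proved by testing both sides against an arbitrary vector
    ([re_ext]), expanding, and comparing real polynomials. *)
Ltac re_expand := unfold vsub; autorewrite with re; cbn [fst snd Cadd Cmul Cconj C0 Defs.C1].

(** * Norm, Cauchy-Schwarz inequality and convergence *)

Section Norm.
Variable H : CHilbert.
Implicit Types (x y z : H) (c : Defs.C) (t : R).

Lemma re_nonneg x : 0 <= re x x.
Proof. apply inner_pos. Qed.

Lemma re_definite x : re x x = 0 -> x = vzero.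
Proof.
  intro E. apply inner_def. rewrite inner_re, E.
  pose proof (re_J_sym H x x). unfold C0. f_equal. lra.
Qed.

Lemma re_ext x y : (forall z, re x z = re y z) -> x = y.
Proof.
  intro E.
  assert (D : vsub x y = vzero).
  { apply re_definite. unfold vsub at 1. rewrite re_addl, re_oppl, E. ring. }
  rewrite <- (vadd_0l H y), <- D. unfold vsub.
  now rewrite <- vadd_assoc, vadd_oppl, vadd_comm, vadd_0l.
Qed.

Lemma hnorm_nonneg x : 0 <= hnorm x.
Proof. apply sqrt_pos. Qed.

Lemma hnorm_sqr x : hnorm x * hnorm x = re x x.
Proof. apply sqrt_sqrt, re_nonneg. Qed.

Lemma hnorm_le_sqr x t : 0 <= t -> re x x <= t * t -> hnorm x <= t.
Proof.
  intros Ht E. rewrite <- hnorm_sqr in E. pose proof (hnorm_nonneg x). nra.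
Qed.

Lemma hnorm_lt_sqr x t : 0 <= t -> re x x < t * t -> hnorm x < t.
Proof.
  intros Ht E. rewrite <- hnorm_sqr in E. pose proof (hnorm_nonneg x). nra.
Qed.

Lemma cauchy_schwarz x y : Rabs (re x y) <= hnorm x * hnorm y.
Proof.
  pose proof (hnorm_nonneg x); pose proof (hnorm_nonneg y).
  pose proof (hnorm_sqr x) as Ex; pose proof (hnorm_sqr y) as Ey.
  assert (Q : forall s t, 0 <= s * s * re x x + 2 * s * t * re x y + t * t * re y y).
  { intros s t. pose proof (re_nonneg (vadd (rscal s x) (rscal t y))) as P.
    revert P. re_expand. rewrite (re_sym H y x). intro P. apply Rle_trans with (1 := P). right. ring. }
  destruct (Req_dec (hnorm x) 0) as [Zx|Zx].
  - rewrite Zx, Rmult_0_l in Ex. symmetry in Ex. apply re_definite in Ex.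
    rewrite Ex, re_zerol, Rabs_R0. apply Rmult_le_pos; apply hnorm_nonneg.
  - destruct (Req_dec (hnorm y) 0) as [Zy|Zy].
    + rewrite Zy, Rmult_0_l in Ey. symmetry in Ey. apply re_definite in Ey.
      rewrite Ey, re_zeror, Rabs_R0. apply Rmult_le_pos; apply hnorm_nonneg.
    + pose proof (Q (hnorm y) (hnorm x)) as P1.
      pose proof (Q (hnorm y) (- hnorm x)) as P2.
      rewrite <- Ex, <- Ey in P1, P2.
      assert (0 < hnorm x * hnorm y) by (apply Rmult_lt_0_compat; lra).
      apply Rabs_le. split; nra.
Qed.

Lemma re_le x y : re x y <= hnorm x * hnorm y.
Proof. pose proof (cauchy_schwarz x y). pose proof (Rle_abs (re x y)). lra. Qed.

Lemma hnorm_triangle x y : hnorm (vadd x y) <= hnorm x + hnorm y.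
Proof.
  pose proof (hnorm_nonneg x); pose proof (hnorm_nonneg y).
  apply hnorm_le_sqr; [lra|]. re_expand. rewrite (re_sym H y x).
  pose proof (re_le x y). rewrite <- !hnorm_sqr. lra.
Qed.

Lemma hnorm_rscal t x : hnorm (rscal t x) = Rabs t * hnorm x.
Proof.
  apply Rsqr_inj; [apply hnorm_nonneg| |].
  - apply Rmult_le_pos; [apply Rabs_pos|apply hnorm_nonneg].
  - rewrite Rsqr_mult, <- Rsqr_abs. unfold Rsqr. rewrite !hnorm_sqr. re_expand. ring.
Qed.

Lemma hnorm_eq_sqr x y : re x x = re y y -> hnorm x = hnorm y.
Proof. intro E. unfold hnorm. unfold re in E. now rewrite E. Qed.

Lemma hnorm_sub_sym x y : hnorm (vsub x y) = hnorm (vsub y x).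
Proof. apply hnorm_eq_sqr. re_expand. ring. Qed.

Lemma hnorm_sub_triangle x y z : hnorm (vsub x z) <= hnorm (vsub x y) + hnorm (vsub y z).
Proof.
  replace (vsub x z) with (vadd (vsub x y) (vsub y z)).
  - apply hnorm_triangle.
  - apply re_ext. intro. re_expand. ring.
Qed.

Lemma hnorm_zero : hnorm (vzero : H) = 0.
Proof. apply Rsqr_0_uniq. unfold Rsqr. rewrite hnorm_sqr. apply re_zerol. Qed.

Lemma hnorm_definite x : hnorm x = 0 -> x = vzero.
Proof. intro E. apply re_definite. rewrite <- hnorm_sqr, E. ring. Qed.

Lemma hnorm_small x : (forall eps, 0 < eps -> hnorm x <= eps) -> x = vzero.
Proof.
  intro E. apply hnorm_definite. pose proof (hnorm_nonneg x).
  destruct (Req_dec (hnorm x) 0) as [Z|Z]; [exact Z|].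
  specialize (E (hnorm x / 2)). lra.
Qed.

Lemma sub_eq x y : vsub x y = vzero -> x = y.
Proof.
  intro E. apply re_ext. intro z.
  pose proof (re_zerol H z) as P. rewrite <- E in P. revert P. re_expand. lra.
Qed.

Definition converges (u : nat -> H) (l : H) : Prop :=
  forall eps, 0 < eps -> exists N, forall n, (N <= n)%nat -> hnorm (vsub (u n) l) < eps.

Definition cauchy (u : nat -> H) : Prop :=
  forall eps, 0 < eps -> exists N, forall m n, (N <= m)%nat -> (N <= n)%nat ->
    hnorm (vsub (u m) (u n)) < eps.

Lemma cauchy_converges u : cauchy u -> exists l, converges u l.
Proof. intro Cu. exact (complete H u Cu). Qed.

Lemma converges_hnorm_le u l x t :
  converges u l -> (exists N, forall n, (N <= n)%nat -> hnorm (vsub (u n) x) <= t) ->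
  hnorm (vsub l x) <= t.
Proof.
  intros Hl [N HN]. apply le_epsilon. intros eps Heps.
  destruct (Hl eps Heps) as [N' HN'].
  specialize (HN (max N N') (Nat.le_max_l _ _)).
  specialize (HN' (max N N') (Nat.le_max_r _ _)).
  pose proof (hnorm_sub_triangle l (u (max N N')) x).
  rewrite (hnorm_sub_sym l (u (max N N'))) in H0. lra.
Qed.

Lemma converges_re u l y t :
  converges u l -> (exists N, forall n, (N <= n)%nat -> re (u n) y <= t) -> re l y <= t.
Proof.
  intros Hl [N HN]. apply le_epsilon. intros eps Heps.
  pose proof (hnorm_nonneg y).
  assert (Hd : 0 < eps / (1 + hnorm y)) by (apply Rdiv_lt_0_compat; lra).
  destruct (Hl _ Hd) as [N' HN'].
  specialize (HN (max N N') (Nat.le_max_l _ _)).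
  specialize (HN' (max N N') (Nat.le_max_r _ _)).
  set (v := u (max N N')) in *. rewrite hnorm_sub_sym in HN'.
  pose proof (re_le (vsub l v) y) as P. revert P. re_expand. intro P.
  assert (hnorm (vsub l v) * hnorm y <= eps); [|unfold vsub in *; lra].
  replace eps with (eps / (1 + hnorm y) * (1 + hnorm y)) by (field; lra).
  apply Rmult_le_compat; try apply hnorm_nonneg; lra.
Qed.

End Norm.
Arguments converges {H} u l.
Arguments cauchy {H} u.

(** * Auxiliary facts on real numbers *)

Lemma Rabs_small_eq0 (r : R) : (forall eps, 0 < eps -> Rabs r <= eps) -> r = 0.
Proof.
  intro E. apply NNPP. intro N. apply Rabs_pos_lt in N.
  specialize (E (Rabs r / 2)). lra.
Qed.

Lemma inv_succ_small (eps : R) : 0 < eps ->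
  exists N, forall n, (N <= n)%nat -> / (INR n + 1) < eps.
Proof.
  intro Heps. destruct (archimed_cor1 eps Heps) as [N [HN HN0]]. exists N.
  intros n Hn. apply Rle_lt_trans with (2 := HN).
  assert (0 < INR N) by (now apply lt_0_INR).
  apply le_INR in Hn. apply Rinv_le_contravar; lra.
Qed.

Lemma inv_succ_pos (n : nat) : 0 < / (INR n + 1).
Proof. apply Rinv_0_lt_compat. pose proof (pos_INR n). lra. Qed.

(** The number [d] is the negated supremum of the values [- f t]. *)
Lemma infimum (T : Type) (P : T -> Prop) (f : T -> R) :
  (exists t, P t) -> (forall t, P t -> 0 <= f t) ->
  exists d, (forall t, P t -> d <= f t) /\
    forall eps, 0 < eps -> exists t, P t /\ f t < d + eps.
Proof.
  intros [t0 Ht0] Hf.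
  destruct (completeness (fun r => exists t, P t /\ r = - f t)) as [m [Hm1 Hm2]].
  - exists 0. intros r [t [Ht ->]]. specialize (Hf t Ht). lra.
  - exists (- f t0), t0. auto.
  - exists (- m). split.
    + intros t Ht. assert (- f t <= m) by (apply Hm1; eauto). lra.
    + intros eps Heps. apply NNPP. intro N.
      assert (m <= m - eps); [|lra].
      apply Hm2. intros r [t [Ht ->]]. apply Rnot_lt_le. intro L.
      apply N. exists t. split; [exact Ht|lra].
Qed.

(** * Orthogonal projection and Riesz representation *)

Section Projection.
Variable H : CHilbert.
Implicit Types (x y z : H) (S : H -> Prop).

Definition real_subspace S : Prop :=
  S vzero /\ (forall x y, S x -> S y -> S (vadd x y)) /\
  (forall t x, S x -> S (rscal t x)).

Definition closure S x : Prop :=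
  forall eps, 0 < eps -> exists y, S y /\ hnorm (vsub x y) < eps.

Lemma closure_re_eq0 S x y : (forall s, S s -> re s y = 0) -> closure S x -> re x y = 0.
Proof.
  intros Hy Cx. apply Rabs_small_eq0. intros eps Heps. pose proof (hnorm_nonneg H y).
  destruct (Cx (eps / (1 + hnorm y))) as [s [Ss Ds]]; [apply Rdiv_lt_0_compat; lra|].
  replace (re x y) with (re (vsub x s) y).
  2:{ re_expand. rewrite (Hy s Ss). ring. }
  apply Rle_trans with (1 := cauchy_schwarz H _ _).
  replace eps with (eps / (1 + hnorm y) * (1 + hnorm y)) by (field; lra).
  apply Rmult_le_compat; try apply hnorm_nonneg; lra.
Qed.

(* A minimizing sequence for the distance from [x] to [S] is Cauchy by the
   parallelogram law. *)
Theorem projection S x : real_subspace S ->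
  exists p, closure S p /\ forall s, S s -> re (vsub x p) s = 0.
Proof.
  intros [S0 [Sadd Sscal]].
  destruct (infimum H S (fun s => re (vsub x s) (vsub x s))) as [d [Hd1 Hd2]].
  { exists vzero. exact S0. }
  { intros. apply re_nonneg. }
  assert (Hu : forall n : nat, exists s, S s /\
    re (vsub x s) (vsub x s) < d + / (INR n + 1)).
  { intro n. apply Hd2, inv_succ_pos. }
  apply choice in Hu. destruct Hu as [u Hu].
  assert (Cu : cauchy u).
  { intros eps Heps.
    (* Both squared distances exceed [d] by less than [eps * eps / 4] and the midpoint is at squared
       distance at least [d], so the identity below leaves less than [eps * eps]. *)
    destruct (inv_succ_small (eps * eps / 4)) as [N HN]; [nra|].
    exists N. intros m n Hm Hn. apply hnorm_lt_sqr; [lra|].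
    destruct (Hu m) as [Sm Dm]. destruct (Hu n) as [Sn Dn].
    pose proof (HN m Hm). pose proof (HN n Hn).
    pose proof (Hd1 _ (Sscal (/ 2) _ (Sadd _ _ Sm Sn))) as Dmn.
    assert (E : re (vsub (u m) (u n)) (vsub (u m) (u n)) =
      2 * re (vsub x (u m)) (vsub x (u m)) + 2 * re (vsub x (u n)) (vsub x (u n))
      - 4 * re (vsub x (rscal (/ 2) (vadd (u m) (u n))))
               (vsub x (rscal (/ 2) (vadd (u m) (u n))))).
    { re_expand. field. }
    rewrite E. lra. }
  destruct (cauchy_converges H u Cu) as [p Hp].
  exists p. split.
  { intros eps Heps. destruct (Hp eps Heps) as [N HN]. exists (u N). split.
    - apply Hu.
    - rewrite hnorm_sub_sym. apply HN. apply le_n. }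
  (* As [p] need not lie in [S], minimality along the line [p + t s] is obtained as a limit of the
     same inequality at [u n]. *)
  assert (Q : forall s t, S s -> 2 * t * re (vsub x p) s <= t * t * re s s).
  { intros s t Ss.
    assert (L : re p (rscal (- (2 * t)) s) <= t * t * re s s - 2 * t * re x s).
    { apply le_epsilon. intros eps Heps.
      destruct (inv_succ_small eps Heps) as [N HN].
      apply converges_re with (1 := Hp). exists N. intros n Hn.
      destruct (Hu n) as [Sn Dn]. pose proof (HN n Hn).
      pose proof (Hd1 _ (Sadd _ _ Sn (Sscal t _ Ss))) as D.
      assert (E : re (vsub x (vadd (u n) (rscal t s))) (vsub x (vadd (u n) (rscal t s)))
        = re (vsub x (u n)) (vsub x (u n)) - 2 * t * re (vsub x (u n)) s
          + t * t * re s s).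
      { re_expand. rewrite (re_sym H s x), (re_sym H s (u n)). ring. }
      rewrite E in D. assert (D' : 2 * t * re (vsub x (u n)) s <= eps + t * t * re s s) by lra.
      revert D'. re_expand. intro D'. lra. }
    revert L. re_expand. intro L. lra. }
  intros s Ss. pose proof (re_nonneg H s). set (r := re (vsub x p) s) in *.
  (* With [t = w = r / (1 + |s|^2)] the inequality reads [2 w^2 (1 + |s|^2) <= w^2 |s|^2] and forces
     [w = 0]; the added 1 covers [s = 0]. *)
  pose proof (Q s (r / (1 + re s s)) Ss) as Qs. fold r in Qs.
  assert (E : r / (1 + re s s) * (r / (1 + re s s)) * re s s
    = r / (1 + re s s) * r - (r / (1 + re s s)) * (r / (1 + re s s))) by (field; lra).
  assert (G : r / (1 + re s s) * r = (r / (1 + re s s)) * (r / (1 + re s s)) * (1 + re s s))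
    by (field; lra).
  set (w := r / (1 + re s s)) in *.
  assert (W : w = 0) by nra.
  unfold w in W. replace r with (r / (1 + re s s) * (1 + re s s)) by (field; lra).
  rewrite W. ring.
Qed.

Lemma linear_manifold_real S : linear_manifold H S -> real_subspace S.
Proof. intros [S0 [Sadd Sscal]]. repeat split; auto. intros. now apply Sscal. Qed.

(** The residual [x - p] of the projection is orthogonal to [S], hence zero, so [x = p] lies in the
    closure. *)
Lemma dense_of_trivial_orthogonal S : real_subspace S ->
  (forall h, (forall s, S s -> re h s = 0) -> h = vzero) -> dense H S.
Proof.
  intros HS Hperp x. destruct (projection S x HS) as [p [Cp Op]].
  rewrite (sub_eq H x p (Hperp _ Op)). exact Cp.
Qed.

(** Take a vector outside the kernel of [l] and remove its projection onto the kernel: a multiple of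
    the residual [q] represents [l]. *)
Theorem riesz (l : H -> R) (c : R) :
  (forall x y, l (vadd x y) = l x + l y) -> (forall t x, l (rscal t x) = t * l x) ->
  (forall x, Rabs (l x) <= c * hnorm x) -> exists g, forall x, l x = re x g.
Proof.
  intros ladd lscal lbound.
  destruct (classic (forall x, l x = 0)) as [Z|NZ].
  { exists vzero. intro x. now rewrite Z, re_zeror. }
  apply not_all_ex_not in NZ. destruct NZ as [f Hf].
  assert (lsub : forall x y, l (vsub x y) = l x - l y).
  { intros x y. replace (vsub x y) with (vadd x (rscal (-1) y)).
    - rewrite ladd, lscal. ring.
    - apply re_ext. intro. re_expand. ring. }
  destruct (projection (fun x => l x = 0) f) as [p [Cp Op]].
  { repeat split.
    - replace (vzero : H) with (rscal 0 (vzero : H)).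
      + rewrite lscal. ring.
      + apply re_ext. intro. re_expand. ring.
    - intros x y Hx Hy. rewrite ladd. lra.
    - intros t x Hx. rewrite lscal, Hx. ring. }
  (* The projection is only known to lie in the closure of the kernel; the bound on [l] makes [l]
     vanish there too. *)
  assert (lp : l p = 0).
  { assert (0 <= Rabs c) by apply Rabs_pos.
    apply Rabs_small_eq0. intros eps Heps.
    destruct (Cp (eps / (1 + Rabs c))) as [s [Ls Ds]]; [apply Rdiv_lt_0_compat; lra|].
    replace (l p) with (l (vsub p s)) by (rewrite lsub, Ls; ring).
    apply Rle_trans with (1 := lbound _).
    replace eps with ((1 + Rabs c) * (eps / (1 + Rabs c))) by (field; lra).
    pose proof (hnorm_nonneg H (vsub p s)). pose proof (Rle_abs c).
    apply Rle_trans with ((1 + Rabs c) * hnorm (vsub p s)).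
    - apply Rmult_le_compat_r; lra.
    - apply Rmult_le_compat_l; lra. }
  set (q := vsub f p) in *.
  assert (lq : l q = l f) by (unfold q; rewrite lsub; lra).
  assert (nq : re q q <> 0).
  { intro E. apply re_definite in E. apply Hf. rewrite <- lq, E.
    pose proof (ladd vzero vzero) as L. rewrite vadd_0l in L. lra. }
  exists (rscal (l f / re q q) q). intro x.
  (* This vector lies in the kernel because [l q = l f], so it is orthogonal to [q]. *)
  pose proof (Op (vsub x (rscal (l x / l f) q))) as O.
  rewrite lsub, lscal, lq in O.
  assert (E : re q (vsub x (rscal (l x / l f) q)) = 0) by (apply O; field; exact Hf).
  revert E. re_expand. rewrite (re_sym H q x). intro E.
  replace (re x q) with (l x / l f * re q q) by lra. field. auto.
Qed.

End Projection.
Arguments real_subspace {H} S.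
Arguments closure {H} S x.

(** * Adjoint of a contraction *)

Section Adjoint.
Variables K H : CHilbert.
Variable b : K -> H.
Hypothesis b_add : forall x y, b (vadd x y) = vadd (b x) (b y).
Hypothesis b_scal : forall c x, b (vscal c x) = vscal c (b x).
Hypothesis b_contr : forall x, hnorm (b x) <= hnorm x.

Lemma b_rscal t x : b (rscal t x) = rscal t (b x).
Proof. apply b_scal. Qed.

Lemma b_sub x y : b (vsub x y) = vsub (b x) (b y).
Proof.
  replace (vsub x y) with (vadd x (rscal (-1) y)).
  - rewrite b_add, b_rscal. apply re_ext. intro. re_expand. ring.
  - apply re_ext. intro. re_expand. ring.
Qed.

Lemma b_zero : b vzero = vzero.
Proof.
  replace (vzero : K) with (rscal 0 (vzero : K)).
  - rewrite b_rscal. apply re_ext. intro. re_expand. ring.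
  - apply re_ext. intro. re_expand. ring.
Qed.

(** Riesz applies for each [h], since the contraction [b] gives the bound [hnorm h]. Linearity of
    [a] is derived afterwards from the adjoint identity. *)
Lemma adjoint_exists : exists a : H -> K, forall h x, re (b x) h = re x (a h).
Proof.
  apply (choice (fun h g => forall x, re (b x) h = re x g)). intro h.
  apply riesz with (c := hnorm h).
  - intros. rewrite b_add. re_expand. ring.
  - intros. rewrite b_rscal. re_expand. ring.
  - intro x. apply Rle_trans with (1 := cauchy_schwarz H _ _).
    rewrite Rmult_comm. apply Rmult_le_compat_l; [apply hnorm_nonneg|apply b_contr].
Qed.

End Adjoint.

Lemma inner_eq0 (V : CHilbert) (x y : V) : re x y = 0 -> re (J x) y = 0 -> inner x y = C0.
Proof. intros E1 E2. rewrite inner_re, E1, E2. unfold C0. f_equal. ring. Qed.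

(** * Finite-dimensional spans and orthogonal complements *)

Section Span.
Variable K : CHilbert.
Implicit Types (x y v : K) (l : list K) (S : K -> Prop).

Fixpoint span l x : Prop :=
  match l with
  | [] => x = vzero
  | v :: l' => exists c y, span l' y /\ x = vadd (vscal c v) y
  end.

Lemma span_manifold l : linear_manifold K (span l).
Proof.
  induction l as [|v l [I0 [Ia Is]]].
  - repeat split; simpl.
    + intros x y -> ->. apply re_ext. intro. re_expand. ring.
    + intros c x ->. apply re_ext. intro. re_expand. ring.
  - repeat split; simpl.
    + exists C0, vzero. split; [exact I0|]. apply re_ext. intro. re_expand. ring.
    + intros x y [c [x' [Hx ->]]] [d [y' [Hy ->]]].
      exists (Cadd c d), (vadd x' y'). split; [auto|].
      apply re_ext. intro. re_expand. ring.
    + intros a x [c [x' [Hx ->]]]. exists (Cmul a c), (vscal a x'). split; [auto|].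
      apply re_ext. intro. re_expand. ring.
Qed.

Lemma span_tail v l x : span l x -> span (v :: l) x.
Proof.
  intro Hx. exists C0, x. split; [exact Hx|]. apply re_ext. intro. re_expand. ring.
Qed.

Lemma span_head v l : span (v :: l) v.
Proof.
  exists Defs.C1, vzero. split; [apply span_manifold|]. apply re_ext. intro. re_expand. ring.
Qed.

Lemma span_app l l' x y : span l x -> span l' y -> span (l ++ l') (vadd x y).
Proof.
  revert x. induction l as [|v l IH]; simpl; intros x Hx Hy.
  - rewrite Hx, vadd_0l. exact Hy.
  - destruct Hx as [c [x' [Hx ->]]]. exists c, (vadd x' y). split; [auto|].
    now rewrite vadd_assoc.
Qed.

(** Only the real part has to vanish; when [S] is stable under complex scalars this is full complex
    orthogonality, by [orth_J]. *)
Definition orth S x : Prop := forall s, S s -> re x s = 0.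

Lemma orth_J S x s : (forall c s, S s -> S (vscal c s)) -> orth S x -> S s ->
  re (J x) s = 0.
Proof.
  intros HS Ox Ss. specialize (Ox _ (HS (0, 1) s Ss)). revert Ox. re_expand. lra.
Qed.

Lemma orth_manifold S : (forall c s, S s -> S (vscal c s)) -> linear_manifold K (orth S).
Proof.
  intro HS. repeat split.
  - intros s Ss. apply re_zerol.
  - intros x y Hx Hy s Ss. re_expand. rewrite (Hx s Ss), (Hy s Ss). ring.
  - intros c x Hx s Ss. re_expand. rewrite (Hx s Ss), (orth_J S x s HS Hx Ss). ring.
Qed.

(** Gram-Schmidt, one vector at a time. Unlike in [projection], the point obtained lies in the
    subspace itself and not only in its closure. *)
Lemma span_projection l x : exists p, span l p /\ orth (span l) (vsub x p).
Proof.
  revert x. induction l as [|v l IH]; intro x.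
  { exists vzero. split; [reflexivity|]. intros s ->. apply re_zeror. }
  destruct (IH v) as [p1 [P1 O1]]. destruct (IH x) as [p2 [P2 O2]].
  destruct (span_manifold l) as [I0 [Ia Is]].
  set (q1 := vsub v p1) in *. set (q2 := vsub x p2) in *.
  assert (Ev : v = vadd q1 p1) by (apply re_ext; intro; unfold q1; re_expand; ring).
  destruct (classic (re q1 q1 = 0)) as [Z|NZ].
  - apply re_definite in Z. exists p2. split; [now apply span_tail|].
    intros s [c [y [Hy ->]]]. rewrite Ev, Z, vadd_0l. apply O2. auto.
  (* The complex coefficient of [q2] along [q1], that is [inner q2 q1] divided by [re q1 q1]. *)
  - set (c := (re q2 q1 / re q1 q1, - re (J q2) q1 / re q1 q1) : Defs.C).
    exists (vadd (vscal c v) (vsub p2 (vscal c p1))). split.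
    { exists c, (vsub p2 (vscal c p1)). split; [|reflexivity].
      unfold vsub. apply Ia; [exact P2|].
      replace (vopp (vscal c p1)) with (vscal (- fst c, - snd c) p1); [auto|].
      apply re_ext. intro. re_expand. ring. }
    replace (vsub x _) with (vsub q2 (vscal c q1)).
    2:{ apply re_ext. intro. unfold q1, q2. re_expand. ring. }
    pose proof (re_J_sym K q1 q1) as J1.
    intros s [d [y [Hy ->]]].
    replace (vadd (vscal d v) y) with (vadd (vscal d q1) (vadd (vscal d p1) y)).
    2:{ rewrite Ev at 1. apply re_ext. intro. re_expand. ring. }
    assert (Y : span l (vadd (vscal d p1) y)) by auto.
    revert Y. generalize (vadd (vscal d p1) y). intros z Hz.
    pose proof (O1 z Hz) as Z1. pose proof (O2 z Hz) as Z2.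
    pose proof (orth_J _ _ _ Is O1 Hz) as Z3.
    re_expand. rewrite Z1, Z2, Z3. replace (re (J q1) q1) with 0 by lra.
    unfold c. simpl. field. exact NZ.
Qed.

(** [C] adds up the absolute real and imaginary parts of the coefficients of [x], so it serves every
    [g] at once. *)
Lemma span_bound l x : span l x -> exists C, 0 <= C /\ forall g d, 0 <= d ->
  (forall m, In m l -> Rabs (re m g) <= d /\ Rabs (re (J m) g) <= d) ->
  Rabs (re x g) <= C * d.
Proof.
  revert x. induction l as [|v l IH]; simpl; intros x Hx.
  - exists 0. split; [lra|]. intros g d Hd _. rewrite Hx, re_zerol, Rabs_R0. lra.
  - destruct Hx as [c [y [Hy ->]]]. destruct (IH y Hy) as [C [HC Hb]].
    pose proof (Rabs_pos (fst c)). pose proof (Rabs_pos (snd c)).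
    exists (Rabs (fst c) + Rabs (snd c) + C). split; [lra|]. intros g d Hd Hm.
    destruct (Hm v (or_introl eq_refl)) as [V1 V2].
    assert (Y : Rabs (re y g) <= C * d) by (apply Hb; auto).
    re_expand. eapply Rle_trans; [apply Rabs_triang|].
    eapply Rle_trans; [apply Rplus_le_compat_r, Rabs_triang|].
    rewrite !Rabs_mult. nra.
Qed.

End Span.
Arguments span {K} l x.
Arguments orth {K} S x.

Lemma inv4_pow_pos n : 0 < (/ 4) ^ n.
Proof. apply pow_lt. lra. Qed.

Lemma inv4_pow_le n : (/ 4) ^ n <= / (INR n + 1).
Proof.
  induction n as [|n IH].
  - simpl. right. field.
  - rewrite S_INR. pose proof (pos_INR n). simpl.
    apply Rle_trans with (/ 4 * / (INR n + 1)); [lra|].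
    rewrite <- Rinv_mult. apply Rinv_le_contravar; lra.
Qed.

(** * Density and infinite codimension of the range of the adjoint *)

Section Range.
Variables K H : CHilbert.
Variable b : K -> H.
Hypothesis b_add : forall x y, b (vadd x y) = vadd (b x) (b y).
Hypothesis b_scal : forall c x, b (vscal c x) = vscal c (b x).
Hypothesis b_contr : forall x, hnorm (b x) <= hnorm x.
Hypothesis b_inj : forall x, b x = vzero -> x = vzero.
Hypothesis b_dense : dense H (fun y => exists x, y = b x).
Hypothesis b_not_onto : exists y, forall x, b x <> y.
Variable a : H -> K.
Hypothesis a_adj : forall h x, re (b x) h = re x (a h).

Lemma a_add h k : a (vadd h k) = vadd (a h) (a k).
Proof.
  apply re_ext. intro z. re_expand. rewrite !(re_sym K _ z), <- !a_adj. re_expand. ring.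
Qed.

Lemma a_scal c h : a (vscal c h) = vscal c (a h).
Proof.
  apply re_ext. intro z. rewrite !(re_sym K _ z), <- !a_adj. re_expand.
  rewrite <- !a_adj. unfold J at 2. rewrite b_scal. reflexivity.
Qed.

(** A vector killed by [a] is orthogonal to the dense range of [b]. *)
Lemma a_inj h : a h = vzero -> h = vzero.
Proof.
  intro E. apply re_definite.
  apply (closure_re_eq0 H (fun y => exists x, y = b x)).
  - intros s [x ->]. now rewrite a_adj, E, re_zeror.
  - exact (b_dense h).
Qed.

(** A vector orthogonal to the range of [a] is killed by the injective [b]. *)
Lemma a_range_dense : dense K (fun x => exists h, x = a h).
Proof.
  apply dense_of_trivial_orthogonal.
  - repeat split.
    + exists vzero. apply re_ext. intro z.
      rewrite !(re_sym K _ z), <- a_adj. re_expand. ring.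
    + intros x y [h ->] [k ->]. exists (vadd h k). now rewrite a_add.
    + intros t x [h ->]. exists (rscal t h). symmetry. apply a_scal.
  - intros f Hf. apply b_inj, re_definite. rewrite a_adj. apply Hf. eauto.
Qed.

(** Otherwise [eta |x| <= |b x|] for all [x], so preimages of a convergent sequence of the range are
    Cauchy. The dense range would then be closed and equal to [H]. *)
Lemma not_bounded_below eta : 0 < eta -> exists g, hnorm g = 1 /\ hnorm (b g) <= eta.
Proof.
  intro Heta. apply NNPP. intro N.
  assert (L : forall x, eta * hnorm x <= hnorm (b x)).
  { intro x. apply Rnot_lt_le. intro L. pose proof (hnorm_nonneg H (b x)).
    assert (0 < hnorm x) by nra. pose proof (Rinv_0_lt_compat _ H1).
    apply N. exists (rscal (/ hnorm x) x).
    rewrite (b_rscal K H b b_scal), !hnorm_rscal, Rabs_pos_eq by lra. split; [field; lra|].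
    apply Rmult_le_reg_l with (hnorm x); [lra|].
    rewrite <- Rmult_assoc, Rinv_r by lra. lra. }
  destruct b_not_onto as [y Hy].
  assert (Hu : forall n : nat, exists x, hnorm (vsub y (b x)) < / (INR n + 1)).
  { intro n. destruct (b_dense y _ (inv_succ_pos n)) as [z [[x ->] Hx]]. eauto. }
  apply choice in Hu. destruct Hu as [u Hu].
  destruct (cauchy_converges K u) as [x Hx].
  { intros eps Heps. destruct (inv_succ_small (eta * eps / 2)) as [M HM]; [nra|].
    exists M. intros m n Hm Hn.
    apply Rmult_lt_reg_l with (1 := Heta). eapply Rle_lt_trans; [apply L|].
    rewrite (b_sub K H b b_add b_scal).
    pose proof (hnorm_sub_triangle H (b (u m)) y (b (u n))) as T.
    rewrite (hnorm_sub_sym H _ y) in T.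
    pose proof (Hu m). pose proof (Hu n). pose proof (HM m Hm). pose proof (HM n Hn). lra. }
  apply (Hy x). symmetry. apply sub_eq, hnorm_small. intros eps Heps.
  destruct (inv_succ_small (eps / 2)) as [M HM]; [lra|].
  destruct (Hx (eps / 2)) as [M' HM']; [lra|].
  set (n := max M M').
  specialize (HM n (Nat.le_max_l _ _)). specialize (HM' n (Nat.le_max_r _ _)).
  pose proof (hnorm_sub_triangle H y (b (u n)) (b x)) as T.
  rewrite <- (b_sub K H b b_add b_scal (u n) x) in T.
  pose proof (b_contr (vsub (u n) x)). pose proof (Hu n). lra.
Qed.

(* Unit vectors with small image are almost orthogonal to the dense range of the adjoint. *)
Lemma small_image_weakly_small l d : 0 < d -> exists eta, 0 < eta /\
  forall g, hnorm g = 1 -> hnorm (b g) <= eta -> forall m, In m l -> Rabs (re m g) <= d.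
Proof.
  intro Hd. induction l as [|v l [eta [Heta IH]]].
  - exists 1. split; [lra|]. intros g _ _ m [].
  - destruct (a_range_dense v (d / 2)) as [x [[h ->] Hh]]; [lra|].
    pose proof (hnorm_nonneg H h).
    exists (Rmin eta (d / 2 / (1 + hnorm h))). split.
    { apply Rmin_glb_lt; [exact Heta|]. apply Rdiv_lt_0_compat; lra. }
    intros g Hg Hbg m [<-|Hm].
    2:{ apply IH; auto. eapply Rle_trans; [exact Hbg|apply Rmin_l]. }
    (* The first term is at most [|v - a h|], as [g] is a unit vector, and the second at most
       [|b g| |h|]; each is at most [d / 2]. *)
    replace (re v g) with (re (vsub v (a h)) g + re (b g) h).
    2:{ rewrite a_adj. re_expand. rewrite (re_sym K g). ring. }
    eapply Rle_trans; [apply Rabs_triang|].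
    pose proof (cauchy_schwarz K (vsub v (a h)) g) as P1. rewrite Hg in P1.
    pose proof (cauchy_schwarz H (b g) h) as P2.
    assert (P3 : hnorm (b g) * hnorm h <= d / 2 / (1 + hnorm h) * (1 + hnorm h)).
    { apply Rmult_le_compat; try apply hnorm_nonneg; [|lra].
      eapply Rle_trans; [exact Hbg|apply Rmin_r]. }
    replace (d / 2 / (1 + hnorm h) * (1 + hnorm h)) with (d / 2) in P3 by (field; lra).
    lra.
Qed.

(* Gliding hump: [z] is a sum of the [4^-n g_n], each unit vector [g_n] having small
   image and being almost orthogonal to [l] and to the previous partial sum. *)
Lemma range_infinite_codim l :
  exists z, forall h x, span l x -> z <> vadd (a h) x.
Proof.
  set (q := fun n : nat => (/ 4) ^ n).
  (* The tolerance at stage [n] is of smaller order than the weight [q n] of the hump; the final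
     contradiction rests on this. *)
  set (d := fun n : nat => q n * / (INR n + 1)).
  assert (Hq : forall n, 0 < q n) by exact inv4_pow_pos.
  assert (Hd : forall n, 0 < d n).
  { intro n. apply Rmult_lt_0_compat; [apply Hq|apply inv_succ_pos]. }
  assert (HG : forall p : nat * K, exists g, hnorm g = 1 /\ hnorm (b g) <= d (fst p) /\
    Rabs (re (snd p) g) <= d (fst p) /\
    forall m, In m l -> Rabs (re m g) <= d (fst p) /\ Rabs (re (J m) g) <= d (fst p)).
  { intros [n s]. simpl.
    (* Adding [map J l] controls imaginary parts as well, since [span] allows complex
       coefficients. *)
    destruct (small_image_weakly_small (s :: l ++ map J l) (d n) (Hd n)) as [eta [Heta W]].
    destruct (not_bounded_below (Rmin eta (d n))) as [g [Hg Hbg]].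
    { apply Rmin_glb_lt; auto. }
    assert (B1 : hnorm (b g) <= eta) by (eapply Rle_trans; [exact Hbg|apply Rmin_l]).
    exists g. repeat split; [exact Hg| | | |].
    - eapply Rle_trans; [exact Hbg|apply Rmin_r].
    - apply W; simpl; auto.
    - apply W; auto. simpl. right. apply in_or_app. auto.
    - apply W; auto. simpl. right. apply in_or_app. right. now apply in_map. }
  apply choice in HG. destruct HG as [G HG].
  set (s := fix s n := match n with
    | O => vzero | S k => vadd (s k) (rscal (q k) (G (k, s k))) end).
  (* The right-hand side is the geometric sum of the [q i] for [n <= i < n + k]. *)
  assert (Hs : forall n k, hnorm (vsub (s (n + k)%nat) (s n)) <= 4 / 3 * (q n - q (n + k)%nat)).
  { intros n k. induction k as [|k IH].
    - rewrite Nat.add_0_r. replace (vsub (s n) (s n)) with (vzero : K).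
      + rewrite hnorm_zero. lra.
      + apply re_ext. intro. re_expand. ring.
    - rewrite Nat.add_succ_r.
      pose proof (hnorm_sub_triangle K (s (S (n + k))) (s (n + k)%nat) (s n)) as T.
      replace (vsub (s (S (n + k))) (s (n + k)%nat))
        with (rscal (q (n + k)%nat) (G ((n + k)%nat, s (n + k)%nat))) in T.
      2:{ apply re_ext. intro. simpl. re_expand. ring. }
      rewrite hnorm_rscal, (proj1 (HG _)), Rabs_pos_eq in T by (left; apply Hq).
      assert (q (S (n + k)) = / 4 * q (n + k)%nat) by reflexivity. lra. }
  assert (Hs' : forall n m, (n <= m)%nat -> hnorm (vsub (s m) (s n)) <= 4 / 3 * q n).
  { intros n m Hm. pose proof (Hs n (m - n)%nat) as P.
    replace (n + (m - n))%nat with m in P by lia. pose proof (Hq m). lra. }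
  destruct (cauchy_converges K s) as [z Hz].
  { intros eps Heps. destruct (inv_succ_small (eps / 3)) as [N HN]; [lra|].
    exists N. intros m n Hm Hn. pose proof (HN N (le_n N)). pose proof (inv4_pow_le N) as P.
    fold (q N) in P. pose proof (Hs' N m Hm). pose proof (Hs' N n Hn).
    pose proof (hnorm_sub_triangle K (s m) (s N) (s n)) as T.
    rewrite (hnorm_sub_sym K (s N)) in T. lra. }
  exists z. intros h x Hx E.
  destruct (span_bound K l x Hx) as [C [HC Hb]].
  pose proof (hnorm_nonneg H h).
  (* Pair [z] with the hump [g]: the hump gives [q n], the later ones at most [q n / 3], the earlier
     ones at most [d n]. If [z = a h + x], the same pairing is [re (b g) h + re x g], at most
     [(|h| + C) d n]. *)
  assert (Main : forall n, 2 / 3 * q n <= (1 + hnorm h + C) * d n).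
  { intro n. destruct (HG (n, s n)) as [G1 [G2 [G3 G4]]]. set (g := G (n, s n)) in *.
    simpl fst in *. simpl snd in *.
    assert (T1 : hnorm (vsub z (s (S n))) <= q n / 3).
    { apply converges_hnorm_le with (1 := Hz). exists (S n). intros m Hm.
      pose proof (Hs' (S n) m Hm) as P. change (q (S n)) with (/ 4 * q n) in P. lra. }
    pose proof (cauchy_schwarz K (vsub z (s (S n))) g) as T2. rewrite G1 in T2.
    assert (T3 : re z g = re (vsub z (s (S n))) g + re (s n) g + q n).
    { simpl. fold g. re_expand. rewrite <- (hnorm_sqr K g), G1. ring. }
    assert (T4 : Rabs (re x g) <= C * d n) by (apply Hb; [left; apply Hd|exact G4]).
    pose proof (cauchy_schwarz H (b g) h) as T5.
    assert (T6 : re z g = re (b g) h + re x g).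
    { rewrite E, a_adj. re_expand. now rewrite (re_sym K g). }
    assert (T7 : hnorm (b g) * hnorm h <= d n * hnorm h)
      by (now apply Rmult_le_compat_r).
    pose proof (Rle_abs (re x g)). pose proof (Rle_abs (re (b g) h)).
    pose proof (Rle_abs (- re (s n) g)) as T8. rewrite Rabs_Ropp in T8.
    pose proof (Rle_abs (- re (vsub z (s (S n))) g)) as T9. rewrite Rabs_Ropp in T9.
    lra. }
  (* For this [n] the right side of [Main] is at most [q n / 2], below [2 / 3 * q n]. *)
  destruct (inv_succ_small (/ (2 * (1 + hnorm h + C)))) as [n Hn].
  { apply Rinv_0_lt_compat. lra. }
  specialize (Hn n (le_n n)). specialize (Main n). unfold d in Main.
  assert (P : (1 + hnorm h + C) * / (INR n + 1) <= / 2).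
  { replace (/ 2) with ((1 + hnorm h + C) * / (2 * (1 + hnorm h + C))) by (field; lra).
    apply Rmult_le_compat_l; lra. }
  pose proof (Hq n). nra.
Qed.

(** * Finite-dimensional subspaces transversal to the range of the adjoint *)

Definition transversal l : Prop := forall h, span l (a h) -> a h = vzero.

(** If [h] is orthogonal to the image, then [a h] is orthogonal to the complement of [span l], so it
    equals its projection and lies in [span l]. Transversality and [a_inj] then give [h = 0]. *)
Lemma image_orth_dense l : transversal l ->
  dense H (fun y => exists x, orth (span l) x /\ y = b x).
Proof.
  intro Tl. destruct (span_manifold K l) as [I0 [Ia Is]].
  destruct (orth_manifold K (span l) Is) as [O0 [Oa Os]].
  apply dense_of_trivial_orthogonal.
  - repeat split.
    + exists vzero. split; [exact O0|]. symmetry. apply (b_zero K H b b_scal).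
    + intros y y' [x [Hx ->]] [x' [Hx' ->]]. exists (vadd x x').
      split; [auto|]. now rewrite b_add.
    + intros t y [x [Hx ->]]. exists (rscal t x). split; [now apply Os|].
      symmetry. apply b_scal.
  - intros h Hh. apply a_inj, Tl.
    destruct (span_projection K l (a h)) as [p [Hp Op]].
    rewrite (sub_eq K (a h) p); [exact Hp|]. apply re_definite.
    unfold vsub at 2. rewrite re_addr, re_oppr, (Op p Hp), <- a_adj, re_sym, Hh; [ring|].
    eauto.
Qed.

(** [image_orth_dense] yields an approximating [v]; if it spoils transversality of [l'], a small
    perturbation inside the complement of [span l] repairs it, by infinite codimension. *)
Lemma transversal_step l l' y eps : transversal l -> transversal l' -> 0 < eps ->
  exists v, orth (span l) v /\ hnorm (vsub y (b v)) < eps /\ transversal (v :: l').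
Proof.
  intros Tl Tl' Heps. destruct (span_manifold K l) as [I0 [Ia Is]].
  destruct (span_manifold K l') as [I0' [Ia' Is']].
  destruct (orth_manifold K (span l) Is) as [O0 [Oa Os]].
  (* The sum of the range of [a] and [span l']: adjoining to [l'] a vector outside it preserves
     transversality. *)
  set (bad := fun x => exists h n, span l' n /\ x = vadd (a h) n).
  assert (bad_add : forall x x', bad x -> bad x' -> bad (vadd x x')).
  { intros x x' [h [n [Hn ->]]] [h' [n' [Hn' ->]]]. exists (vadd h h'), (vadd n n').
    split; [auto|]. rewrite a_add. apply re_ext. intro. re_expand. ring. }
  assert (bad_scal : forall c x, bad x -> bad (vscal c x)).
  { intros c x [h [n [Hn ->]]]. exists (vscal c h), (vscal c n). split; [auto|].
    rewrite a_scal. apply vscal_addr. }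
  assert (good : exists v, orth (span l) v /\ hnorm (vsub y (b v)) < eps /\ ~ bad v).
  { destruct (image_orth_dense l Tl y eps Heps) as [z [[v [Ov ->]] Hv]].
    destruct (classic (bad v)) as [Bv|]; [|eauto].
    (* Including [l] in the list allows the projection of [z] on [span l] to be subtracted without
       entering [bad]. *)
    destruct (range_infinite_codim (l' ++ l)) as [z Hz].
    destruct (span_projection K l z) as [p [Hp Op]].
    set (w := vsub z p) in *.
    assert (Bw : ~ bad w).
    { intros [h [n [Hn E]]]. apply (Hz h (vadd n p)); [now apply span_app|].
      rewrite vadd_assoc, <- E. apply re_ext. intro. unfold w. re_expand. ring. }
    pose proof (hnorm_nonneg H (b w)).
    (* Small enough that [t |b w|] stays below the slack left in the approximation of [y]. *)
    set (t := (eps - hnorm (vsub y (b v))) / (1 + hnorm (b w))).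
    assert (Ht : 0 < t) by (apply Rdiv_lt_0_compat; lra).
    exists (vadd v (rscal t w)). split; [|split].
    - apply Oa; [exact Ov|now apply Os].
    - pose proof (hnorm_triangle H (vsub y (b v)) (rscal (- t) (b w))) as T.
      rewrite hnorm_rscal, Rabs_Ropp, Rabs_pos_eq in T by lra.
      replace (vsub y (b (vadd v (rscal t w))))
        with (vadd (vsub y (b v)) (rscal (- t) (b w))).
      2:{ rewrite b_add, (b_rscal K H b b_scal). apply re_ext. intro. re_expand. ring. }
      assert (t * (1 + hnorm (b w)) = eps - hnorm (vsub y (b v)))
        by (unfold t; field; lra).
      lra.
    - intro Bvw. apply Bw.
      replace w with (rscal (/ t) (vadd (vadd v (rscal t w)) (rscal (-1) v))).
      + apply bad_scal, bad_add; [exact Bvw|now apply bad_scal].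
      + apply re_ext. intro. re_expand. field. lra. }
  destruct good as [v [Ov [Hv Bv]]]. exists v. split; [exact Ov|split; [exact Hv|]].
  intros h [c [n [Hn E]]].
  destruct (Req_dec (fst c * fst c + snd c * snd c) 0) as [Zc|Nc].
  - assert (fst c = 0) by nra. assert (snd c = 0) by nra.
    assert (E' : a h = n).
    { rewrite E. apply re_ext. intro. re_expand. rewrite H0, H1. ring. }
    apply Tl'. now rewrite E'.
  - exfalso. apply Bv.
    (* [r] is the squared modulus of [c], so the scalar below is [1 / c]; solving for [v] puts it in
       [bad]. *)
    set (r := fst c * fst c + snd c * snd c) in *.
    replace v with (vscal (fst c / r, - snd c / r) (vadd (a h) (rscal (-1) n))).
    + apply bad_scal. exists h, (rscal (-1) n). split; [now apply Is'|reflexivity].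
    + rewrite E. apply re_ext. intro. unfold r in *. re_expand. field. exact Nc.
Qed.

Definition admissible (s : list K * list K) : Prop :=
  transversal (fst s) /\ transversal (snd s) /\
  forall x y, span (fst s) x -> span (snd s) y -> re x y = 0.

Lemma admissible_step s y eps : admissible s -> 0 < eps -> exists v w,
  hnorm (vsub y (b v)) < eps /\ hnorm (vsub y (b w)) < eps /\
  admissible (v :: fst s, w :: snd s).
Proof.
  destruct s as [l l']. intros [Tl [Tl' O]] Heps. simpl in *.
  destruct (transversal_step l' l y eps Tl' Tl Heps) as [v [Ov [Hv Tv]]].
  (* [w] is taken orthogonal to the list already enlarged by [v], so the two new vectors are
     orthogonal to each other. *)
  destruct (transversal_step (v :: l) l' y eps Tv Tl' Heps) as [w [Ow [Hw Tw]]].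
  exists v, w. split; [exact Hv|split; [exact Hw|]].
  split; [exact Tv|split; [exact Tw|]]. simpl fst. simpl snd.
  destruct (span_manifold K (v :: l)) as [_ [_ Is]].
  destruct (orth_manifold K (span (v :: l)) Is) as [_ [Oa Os]].
  destruct (span_manifold K l') as [_ [_ Is']].
  destruct (orth_manifold K (span l') Is') as [_ [Oa' Os']].
  intros x z Hx [d [n [Hn ->]]]. rewrite re_addr, (re_sym K x (vscal d w)).
  rewrite (Os d w Ow x Hx).
  destruct Hx as [c [m [Hm ->]]]. rewrite re_addl, (Os' c v Ov n Hn), (O m n Hm Hn). ring.
Qed.

(** * Alternating construction and the orthogonal splitting *)

Theorem orthogonal_splitting : separable H -> exists D1 D2 : K -> Prop,
  linear_manifold K D1 /\ linear_manifold K D2 /\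
  (forall f, exists f1 f2, D1 f1 /\ D2 f2 /\ f = vadd f1 f2) /\
  dense H (fun y => exists x, D1 x /\ y = b x) /\
  dense H (fun y => exists x, D2 x /\ y = b x) /\
  (forall f g, D1 f -> D2 g -> inner f g = C0).
Proof.
  intros [e He].
  (* Stage [k] codes a pair [(j, i)]: the target is [e j] and the tolerance [1 / (i + 1)], so every
     target recurs with all tolerances. *)
  set (y := fun k => e (fst (Cantor.of_nat k))).
  set (eps := fun k => / (INR (snd (Cantor.of_nat k)) + 1)).
  assert (Hy : forall x r, 0 < r -> exists k, hnorm (vsub x (y k)) + eps k < r).
  { intros x r Hr. destruct (He x (r / 2)) as [z [[j ->] Hj]]; [lra|].
    destruct (inv_succ_small (r / 2)) as [i Hi]; [lra|]. specialize (Hi i (le_n i)).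
    exists (Cantor.to_nat (j, i)). unfold y, eps. rewrite Cantor.cancel_of_to.
    simpl fst. simpl snd. lra. }
  (* The state carries its proof of admissibility, so that [choice] yields a step function that can
     be iterated. *)
  assert (Hstep : forall p : nat * {s | admissible s}, exists s' : {s | admissible s},
    exists v w, proj1_sig s' = (v :: fst (proj1_sig (snd p)), w :: snd (proj1_sig (snd p)))
      /\ hnorm (vsub (y (fst p)) (b v)) < eps (fst p)
      /\ hnorm (vsub (y (fst p)) (b w)) < eps (fst p)).
  { intros [k [s Hs]]. simpl.
    destruct (admissible_step s (y k) (eps k) Hs (inv_succ_pos _)) as [v [w [Hv [Hw A]]]].
    exists (exist _ _ A), v, w. auto. }
  apply choice in Hstep. destruct Hstep as [next Hnext].
  assert (A0 : admissible ([], [])).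
  { assert (transversal []) by (intros h Hh; exact Hh).
    repeat split; auto. intros x z -> _. apply re_zerol. }
  set (st := fix st k := match k with O => exist admissible _ A0 | S k => next (k, st k) end).
  set (l1 := fun k => fst (proj1_sig (st k))). set (l2 := fun k => snd (proj1_sig (st k))).
  assert (Hl : forall k, exists v w, l1 (S k) = v :: l1 k /\ l2 (S k) = w :: l2 k /\
    hnorm (vsub (y k) (b v)) < eps k /\ hnorm (vsub (y k) (b w)) < eps k).
  { intro k. destruct (Hnext (k, st k)) as [v [w [E [Hv Hw]]]]. exists v, w.
    change (l1 (S k)) with (fst (proj1_sig (next (k, st k)))).
    change (l2 (S k)) with (snd (proj1_sig (next (k, st k)))). rewrite E. auto. }
  assert (Mono : forall k j, (k <= j)%nat ->
    (forall x, span (l1 k) x -> span (l1 j) x) /\ (forall x, span (l2 k) x -> span (l2 j) x)).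
  { intros k j Hkj. induction Hkj as [|j _ [IH1 IH2]]; [auto|].
    destruct (Hl j) as [v [w [E1 [E2 _]]]]. rewrite E1, E2.
    split; intros x Hx; apply span_tail; auto. }
  assert (O12 : forall k j x z, span (l1 k) x -> span (l2 j) z -> re x z = 0).
  { intros k j x z Hx Hz. destruct (proj2_sig (st (max k j))) as [_ [_ O]]. apply O.
    - apply (Mono k); [lia|exact Hx].
    - apply (Mono j); [lia|exact Hz]. }
  (* [D1] contains every vector of the first family and [D2] every vector of the second; both images
     are therefore dense. *)
  set (D1 := orth (fun x => exists k, span (l2 k) x)).
  set (D2 := orth D1).
  assert (M1 : linear_manifold K D1).
  { apply orth_manifold. intros c x [k Hx]. exists k. now apply span_manifold. }
  assert (M2 : linear_manifold K D2) by (apply orth_manifold, M1).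
  exists D1, D2. split; [exact M1|split; [exact M2|split; [|split; [|split]]]].
  (* [D1] is closed, being an orthogonal complement, so the projection [p] lies in it and the
     residual lies in [D2]. *)
  - intro f. destruct (projection K D1 f (linear_manifold_real K D1 M1)) as [p [Cp Op]].
    exists p, (vsub f p). split; [|split; [exact Op|]].
    + intros s Hs. apply (closure_re_eq0 K D1); [|exact Cp].
      intros x Hx. now apply Hx.
    + apply re_ext. intro. re_expand. ring.
  - intros x r Hr. destruct (Hy x r Hr) as [k Hk].
    destruct (Hl k) as [v [w [E1 [E2 [Hv Hw]]]]].
    exists (b v). split.
    + exists v. split; [|reflexivity]. intros z [j Hz]. apply (O12 (S k) j); [|exact Hz].
      rewrite E1. apply span_head.
    + pose proof (hnorm_sub_triangle H x (y k) (b v)). lra.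
  - intros x r Hr. destruct (Hy x r Hr) as [k Hk].
    destruct (Hl k) as [v [w [E1 [E2 [Hv Hw]]]]].
    exists (b w). split.
    + exists w. split; [|reflexivity]. intros z Hz. rewrite re_sym. apply Hz.
      exists (S k). rewrite E2. apply span_head.
    + pose proof (hnorm_sub_triangle H x (y k) (b w)). lra.
  - intros f g Hf Hg. apply inner_eq0; rewrite re_sym; [now apply Hg|].
    rewrite re_Jr, (orth_J K D1 g f (proj2 (proj2 M1)) Hg Hf). ring.
Qed.

End Range.

(** * The domain of a self-adjoint operator as a Hilbert space under the graph inner product *)

Section GraphSpace.
Variable H : CHilbert.
Variable dom : H -> Prop.
Variable B : H -> H.
Hypothesis Hsa : self_adjoint H dom B.

Lemma dom_add x y : dom x -> dom y -> dom (vadd x y).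
Proof. apply Hsa. Qed.

Lemma dom_scal c x : dom x -> dom (vscal c x).
Proof. apply Hsa. Qed.

Lemma dom_zero : dom vzero.
Proof. exact (proj1 (proj1 (proj1 Hsa))). Qed.

Lemma B_add x y : dom x -> dom y -> B (vadd x y) = vadd (B x) (B y).
Proof. apply Hsa. Qed.

Lemma B_scal c x : dom x -> B (vscal c x) = vscal c (B x).
Proof. apply Hsa. Qed.

Lemma vopp_scal (x : H) : vopp x = rscal (-1) x.
Proof. apply re_ext. intro. re_expand. ring. Qed.

Lemma dom_opp x : dom x -> dom (vopp x).
Proof. intro Hx. rewrite vopp_scal. now apply dom_scal. Qed.

Lemma B_opp x : dom x -> B (vopp x) = vopp (B x).
Proof. intro Hx. rewrite !vopp_scal. now apply B_scal. Qed.

Lemma re_symmetric x y : dom x -> dom y -> re (B x) y = re x (B y).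
Proof.
  intros Hx Hy. unfold re. f_equal. now apply (proj2 (proj2 (proj2 Hsa))).
Qed.

(** The test vector [J x] supplies the imaginary part, so self-adjointness puts [y] in [dom]; then
    [B y - z] is orthogonal to the dense domain. This serves both for closedness of [B] and for the
    orthogonal complement of its range. *)
Lemma adjoint_graph y z : (forall x, dom x -> re (B x) y = re x z) -> dom y /\ B y = z.
Proof.
  intro E.
  assert (Dy : dom y).
  { apply (proj1 (proj2 (proj2 Hsa))). exists z. intros x Hx.
    rewrite !inner_re. rewrite (E x Hx), <- (E (J x)); [|now apply dom_scal].
    unfold J at 2. now rewrite B_scal. }
  split; [exact Dy|]. apply sub_eq, re_definite.
  apply (closure_re_eq0 H dom); [|exact (proj1 (proj2 Hsa) _)].
  intros x Hx. re_expand. rewrite <- (re_symmetric x y Hx Dy), (E x Hx). ring.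
Qed.

Definition graph_carrier : Type := {x : H | dom x}.
Implicit Types u v : graph_carrier.

Lemma graph_ext u v : proj1_sig u = proj1_sig v -> u = v.
Proof.
  destruct u as [x Hx], v as [y Hy]. simpl. intros <-. f_equal. apply proof_irrelevance.
Qed.

Definition graph_inner_sig u v : Defs.C := graph_inner H B (proj1_sig u) (proj1_sig v).

Lemma graph_re x y : fst (graph_inner H B x y) = re (B x) (B y) + re x y.
Proof. reflexivity. Qed.

Definition gzero : graph_carrier := exist _ _ dom_zero.
Definition gadd u v : graph_carrier :=
  exist _ _ (dom_add _ _ (proj2_sig u) (proj2_sig v)).
Definition gopp u : graph_carrier := exist _ _ (dom_opp _ (proj2_sig u)).
Definition gscal c u : graph_carrier := exist _ _ (dom_scal c _ (proj2_sig u)).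

(* Cauchy sequences in the graph norm converge because a self-adjoint operator is closed. *)
Lemma graph_complete (u : nat -> graph_carrier) :
  (forall eps, 0 < eps -> exists N, forall m n, (N <= m)%nat -> (N <= n)%nat ->
    sqrt (fst (graph_inner_sig (gadd (u m) (gopp (u n))) (gadd (u m) (gopp (u n))))) < eps) ->
  exists l, forall eps, 0 < eps -> exists N, forall n, (N <= n)%nat ->
    sqrt (fst (graph_inner_sig (gadd (u n) (gopp l)) (gadd (u n) (gopp l)))) < eps.
Proof.
  assert (E : forall v w, fst (graph_inner_sig (gadd v (gopp w)) (gadd v (gopp w))) =
    re (vsub (B (proj1_sig v)) (B (proj1_sig w))) (vsub (B (proj1_sig v)) (B (proj1_sig w)))
    + re (vsub (proj1_sig v) (proj1_sig w)) (vsub (proj1_sig v) (proj1_sig w))).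
  { intros [x Hx] [y Hy]. unfold graph_inner_sig. rewrite graph_re. simpl.
    rewrite B_add, B_opp by auto using dom_opp. reflexivity. }
  intro Cu.
  destruct (cauchy_converges H (fun n => proj1_sig (u n))) as [x Hx].
  { intros eps Heps. destruct (Cu eps Heps) as [N HN]. exists N. intros m n Hm Hn.
    specialize (HN m n Hm Hn). rewrite E in HN.
    eapply Rle_lt_trans; [|exact HN]. apply sqrt_le_1_alt.
    pose proof (re_nonneg H (vsub (B (proj1_sig (u m))) (B (proj1_sig (u n))))).
    unfold re in *. lra. }
  destruct (cauchy_converges H (fun n => B (proj1_sig (u n)))) as [y Hy].
  { intros eps Heps. destruct (Cu eps Heps) as [N HN]. exists N. intros m n Hm Hn.
    specialize (HN m n Hm Hn). rewrite E in HN.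
    eapply Rle_lt_trans; [|exact HN]. apply sqrt_le_1_alt.
    pose proof (re_nonneg H (vsub (proj1_sig (u m)) (proj1_sig (u n)))).
    unfold re in *. lra. }
  (* Symmetry of [B] on the pairs [u n], [z] passes to the limit, so the limit [(x, y)] lies on the
     graph. *)
  destruct (adjoint_graph x y) as [Dx Bx].
  { intros z Hz.
    assert (Q : forall s, re (vsub x (proj1_sig (u s))) (B z)
      = re (B z) x - re (B (proj1_sig (u s))) z).
    { intro s. rewrite (re_symmetric _ z (proj2_sig (u s)) Hz). re_expand.
      now rewrite (re_sym H x). }
    apply Rminus_diag_uniq, Rabs_small_eq0. intros eps Heps.
    set (c := 1 + hnorm (B z) + hnorm z).
    pose proof (hnorm_nonneg H (B z)). pose proof (hnorm_nonneg H z).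
    assert (Hd : 0 < eps / c) by (apply Rdiv_lt_0_compat; unfold c; lra).
    destruct (Hx _ Hd) as [N HN]. destruct (Hy _ Hd) as [N' HN'].
    set (n := max N N').
    specialize (HN n (Nat.le_max_l _ _)). specialize (HN' n (Nat.le_max_r _ _)).
    simpl in HN, HN'.
    pose proof (cauchy_schwarz H (vsub x (proj1_sig (u n))) (B z)) as P1.
    pose proof (cauchy_schwarz H (vsub (B (proj1_sig (u n))) y) z) as P2.
    rewrite hnorm_sub_sym in HN.
    replace (re (B z) x - re z y) with (re (vsub x (proj1_sig (u n))) (B z)
      + re (vsub (B (proj1_sig (u n))) y) z).
    2:{ rewrite Q. re_expand. rewrite (re_sym H y z). ring. }
    eapply Rle_trans; [apply Rabs_triang|].
    replace eps with (eps / c * c) by (unfold c; field; lra). unfold c at 2. nra. }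
  exists (exist _ x Dx). intros eps Heps.
  destruct (Hx (eps / 2)) as [N HN]; [lra|]. destruct (Hy (eps / 2)) as [N' HN']; [lra|].
  exists (max N N'). intros n Hn. rewrite E. simpl. rewrite Bx.
  specialize (HN n ltac:(lia)). specialize (HN' n ltac:(lia)).
  rewrite <- !hnorm_sqr. rewrite <- (sqrt_Rsqr eps) by lra.
  simpl in HN, HN'.
  pose proof (hnorm_nonneg H (vsub (proj1_sig (u n)) x)).
  pose proof (hnorm_nonneg H (vsub (B (proj1_sig (u n))) y)).
  apply sqrt_lt_1_alt. unfold Rsqr. split; nra.
Qed.

(** Built transparently, so that its carrier and inner product unfold to those of [graph_carrier]
    and [graph_inner_sig]. *)
Definition graph_space : CHilbert.
Proof.
  refine {| carrier := graph_carrier; vzero := gzero; vadd := gadd; vopp := gopp;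
    vscal := gscal; inner := graph_inner_sig; complete := graph_complete |}.
  - intros. apply graph_ext, vadd_assoc.
  - intros. apply graph_ext, vadd_comm.
  - intros. apply graph_ext, vadd_0l.
  - intros. apply graph_ext, vadd_oppl.
  - intros. apply graph_ext, vscal_1.
  - intros. apply graph_ext, vscal_assoc.
  - intros. apply graph_ext, vscal_addr.
  - intros. apply graph_ext, vscal_addl.
  - intros [x Hx] [y Hy] [z Hz]. unfold graph_inner_sig, graph_inner, Cadd. simpl.
    rewrite B_add by auto. rewrite !inner_addl. simpl. f_equal; ring.
  - intros c [x Hx] [y Hy]. unfold graph_inner_sig, graph_inner, Cadd. simpl.
    rewrite B_scal by auto. rewrite !inner_scall. simpl. unfold Cmul. simpl. f_equal; ring.
  - intros [x Hx] [y Hy]. unfold graph_inner_sig, graph_inner, Cadd. simpl.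
    rewrite (inner_conj H (B x)), (inner_conj H x). unfold Cconj. simpl. f_equal. ring.
  - intros [x Hx]. unfold graph_inner_sig. rewrite graph_re. simpl.
    pose proof (re_nonneg H x). pose proof (re_nonneg H (B x)). lra.
  - intros [x Hx] E. apply graph_ext. simpl. apply (f_equal fst) in E.
    unfold graph_inner_sig in E. rewrite graph_re in E. simpl in E.
    pose proof (re_nonneg H x). pose proof (re_nonneg H (B x)).
    apply re_definite. lra.
Defined.

Definition graph_map (u : graph_space) : H := B (proj1_sig u).

Lemma graph_map_add (u v : graph_space) : graph_map (vadd u v) = vadd (graph_map u) (graph_map v).
Proof. apply B_add; apply proj2_sig. Qed.

Lemma graph_map_scal c (u : graph_space) : graph_map (vscal c u) = vscal c (graph_map u).
Proof. apply B_scal, proj2_sig. Qed.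

Lemma graph_map_contr u : hnorm (graph_map u) <= hnorm (u : graph_space).
Proof.
  apply sqrt_le_1_alt. change (re (B (proj1_sig u)) (B (proj1_sig u)) <=
    re (B (proj1_sig u)) (B (proj1_sig u)) + re (proj1_sig u) (proj1_sig u)).
  pose proof (re_nonneg H (proj1_sig u)). lra.
Qed.

(** By [adjoint_graph], a vector orthogonal to the range of [B] lies in the kernel of [B], which is
    trivial. *)
Lemma graph_map_dense : trivial_kernel H dom B ->
  dense H (fun y => exists x : graph_space, y = graph_map x).
Proof.
  intro Hker. apply dense_of_trivial_orthogonal.
  - repeat split.
    + exists vzero. symmetry. exact (b_zero graph_space H graph_map graph_map_scal).
    + intros y z [u ->] [v ->]. exists (vadd u v). now rewrite graph_map_add.
    + intros t y [u ->]. exists (rscal t u). symmetry. apply graph_map_scal.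
  - intros h Hh. destruct (adjoint_graph h vzero) as [Dh Bh].
    + intros x Hx. rewrite re_zeror, re_sym. apply Hh.
      now exists (exist _ x Hx : graph_space).
    + now apply Hker.
Qed.

End GraphSpace.

(** * Transfer of the splitting from the graph space to manifolds of [H] *)

Theorem theorem3p28 (H : CHilbert)
  (Hsep : separable H) (Hinf : infinite_dimensional H)
  (dom : H -> Prop) (B : H -> H)
  (Hsa : self_adjoint H dom B) (Hnn : nonnegative H dom B)
  (Hunb : unbounded H dom B) (Hker : trivial_kernel H dom B)
  (Hran : range_not_whole H dom B) :
  exists D1 D2 : H -> Prop,
    linear_manifold H D1 /\ linear_manifold H D2 /\
    (forall x, D1 x -> dom x) /\ (forall x, D2 x -> dom x) /\
    (* (1) D1 + D2 = dom B *)
    (forall f, dom f -> exists f1 f2, D1 f1 /\ D2 f2 /\ f = vadd f1 f2) /\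
    (* (2) B D1 and B D2 dense *)
    dense H (image H B D1) /\ dense H (image H B D2) /\
    (* moreover: D1 ∩ D2 = {0} and D1 ⊥ D2 in the graph inner product *)
    (forall x, D1 x -> D2 x -> x = vzero) /\
    (forall f g, D1 f -> D2 g -> graph_inner H B f g = C0).
Proof.
  set (K := graph_space H dom B Hsa). set (b := graph_map H dom B Hsa : K -> H).
  pose proof (graph_map_add H dom B Hsa : forall x y, b (vadd x y) = vadd (b x) (b y))
    as b_add.
  pose proof (graph_map_scal H dom B Hsa : forall c x, b (vscal c x) = vscal c (b x))
    as b_scal.
  pose proof (graph_map_contr H dom B Hsa : forall x, hnorm (b x) <= hnorm x) as b_contr.
  destruct (adjoint_exists K H b b_add b_scal b_contr) as [a Ha].
  destruct (orthogonal_splitting K H b b_add b_scal b_contr) with (a := a)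
    as [D1 [D2 [M1 [M2 [Hsum [Hd1 [Hd2 Hperp]]]]]]]; auto.
  { intros [x Hx] E. apply graph_ext. now apply Hker. }
  { now apply graph_map_dense. }
  { destruct Hran as [y Hy]. exists y. intros [x Hx] E. apply Hy. now exists x. }
  assert (Hman : forall D : K -> Prop, linear_manifold K D ->
    linear_manifold H (fun x => exists u : K, D u /\ proj1_sig u = x)).
  { intros D [D0 [Da Ds]]. repeat split.
    - exists vzero. auto.
    - intros x y [u [Du <-]] [v [Dv <-]]. exists (vadd u v). auto.
    - intros c x [u [Du <-]]. exists (vscal c u). auto. }
  assert (Hdense : forall D : K -> Prop, dense H (fun y => exists x, D x /\ y = b x) ->
    dense H (image H B (fun x => exists u : K, D u /\ proj1_sig u = x))).
  { intros D HD x eps Heps. destruct (HD x eps Heps) as [y [[u [Du ->]] Hu]].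
    exists (b u). split; [|exact Hu]. exists (proj1_sig u). eauto. }
  exists (fun x => exists u : K, D1 u /\ proj1_sig u = x),
    (fun x => exists u : K, D2 u /\ proj1_sig u = x).
  split; [auto|]. split; [auto|].
  split; [intros x [u [_ <-]]; apply proj2_sig|].
  split; [intros x [u [_ <-]]; apply proj2_sig|].
  split; [|split; [auto|split; [auto|split]]].
  - intros f Hf. destruct (Hsum (exist _ f Hf)) as [f1 [f2 [H1 [H2 E]]]].
    exists (proj1_sig f1), (proj1_sig f2). split; [eauto|split; [eauto|]].
    exact (f_equal (@proj1_sig _ _) E).
  (* A common element is graph-orthogonal to itself, and the graph inner product is definite. *)
  - intros x [u [Du <-]] [v [Dv E]]. apply graph_ext in E. subst v.
    pose proof (inner_def K u (Hperp u u Du Dv)) as Z. now rewrite Z.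
  - intros f g [u [Du <-]] [v [Dv <-]]. exact (Hperp u v Du Dv).
Qed.
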